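(* Let $R$ be a noetherian commutative ring with identity, let $A$ be an $R$-algebra, and let $(F_A,f_A)$ be the free averaging $R$-algebra on $A$. If $(F_A,f_A)$ is a noetherian averaging $R$-algebra, then $A$ is a noetherian $R$-algebra.
   Context: All rings and algebras are commutative with identity. An averaging operator on an $R$-algebra $A$ is an $R$-module endomorphism $f:A\to A$ with $f(xf(y))=f(x)f(y)$ for all $x,y\in A$; $(A,f)$ is then an averaging $R$-algebra. An averaging ideal of $(A,f)$ is an ideal $I$ of $A$ with $f(I)\subseteq I$. $(A,f)$ is a noetherian averaging $R$-algebra if there is no infinite strictly ascending chain of averaging ideals of $(A,f)$. A noetherian $R$-algebra is one with no infinite strictly ascending chain of ideals. The free averaging $R$-algebra on $A$ is $(F_A,f_A)$ with $F_A=A\otimes_R S(A)$ (tensor product algebra; $S(A)$ the symmetric algebra of the $R$-module $A$) and $f_A$ the $R$-linear map with $f_A(a\otimes s)=1_A\otimes(as)$, where $a$ is regarded in $S^1(A)=A$; the structure map is $i_A(a)=a\otimes 1_R$. *)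

(* Defs.v *)
From HB Require Import structures.
From mathcomp Require Import all_boot all_algebra.
From mathcomp Require Import boolp classical_sets.

Set Implicit Arguments.
Unset Strict Implicit.
Unset Printing Implicit Defensive.

Import GRing.Theory.
Local Open Scope ring_scope.
Local Open Scope quotient_scope.

(* [comAlgType R] requires [1 != 0]; commutative algebras are given here by
   their structure map, so that the zero algebra is not excluded. *)
Record comPzAlg (R : comPzRingType) := ComPzAlg {
  alg_ring :> comPzRingType;
  alg_map : {rmorphism R -> alg_ring}
}.

Definition alg_mod (R : comPzRingType) (A : comPzAlg R) : Type := A.

Section AlgebraAsModule.
Variables (R : comPzRingType) (A : comPzAlg R).

HB.instance Definition _ := GRing.Zmodule.on (alg_mod A).

Definition alg_scale (r : R) (x : alg_mod A) : alg_mod A := alg_map A r * x.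

Fact alg_scaleA r s x : alg_scale r (alg_scale s x) = alg_scale (r * s) x.
Proof. by rewrite /alg_scale rmorphM mulrA. Qed.

Fact alg_scale1 : left_id 1 alg_scale.
Proof. by move=> x; rewrite /alg_scale rmorph1 mul1r. Qed.

Fact alg_scaleDr : right_distributive alg_scale +%R.
Proof. by move=> r x y; apply: mulrDr. Qed.

Fact alg_scaleDl x : {morph alg_scale^~ x : r s / r + s}.
Proof. by move=> r s; rewrite /alg_scale rmorphD; apply: mulrDl. Qed.

HB.instance Definition _ := GRing.Zmodule_isLmodule.Build R (alg_mod A)
  alg_scaleA alg_scale1 alg_scaleDr alg_scaleDl.

End AlgebraAsModule.

Section Noetherian.
Local Open Scope classical_set_scope.

Definition is_ideal (A : comPzRingType) (I : set A) : Prop :=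
  [/\ I 0, (forall x y, I x -> I y -> I (x + y)) &
      (forall a x, I x -> I (a * x))].

Definition noetherian (A : comPzRingType) : Prop :=
  ~ exists I : nat -> set A,
      (forall n, is_ideal (I n)) /\ (forall n, I n `<` I n.+1).

Record averagingAlg (R : comPzRingType) := AveragingAlg {
  avg_alg :> comPzAlg R;
  avg_op : avg_alg -> avg_alg;
  avg_linear : linear (avg_op : alg_mod avg_alg -> alg_mod avg_alg);
  avg_opP : forall x y, avg_op (x * avg_op y) = avg_op x * avg_op y
}.

Definition is_averaging_ideal (R : comPzRingType) (X : averagingAlg R)
    (I : set X) : Prop :=
  is_ideal I /\ @avg_op R X @` I `<=` I.

Definition noetherian_averaging (R : comPzRingType) (X : averagingAlg R) :
    Prop :=
  ~ exists I : nat -> set X,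
      (forall n, is_averaging_ideal (I n)) /\ (forall n, I n `<` I n.+1).

End Noetherian.

(* Finite formal sums of elements of T are sequences, with [++] as addition;
   [fsum_eq rel] is the least additive congruence containing [rel] for which
   addition is commutative. *)
Inductive fsum_eq (T : Type) (rel : seq T -> seq T -> Prop) :
    seq T -> seq T -> Prop :=
| FsRel s t : rel s t -> fsum_eq rel s t
| FsRefl s : fsum_eq rel s s
| FsSym s t : fsum_eq rel s t -> fsum_eq rel t s
| FsTrans s t u : fsum_eq rel s t -> fsum_eq rel t u -> fsum_eq rel s u
| FsCat s s' t t' : fsum_eq rel s s' -> fsum_eq rel t t' ->
    fsum_eq rel (s ++ t) (s' ++ t')
| FsCatC s t : fsum_eq rel (s ++ t) (t ++ s).

(* Data presenting a commutative R-algebra whose elements are formal sums of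
   elements of [gen] modulo [grel]; the product extends [gmul] biadditively
   and the structure map sends r to the one-term sum [gmap r]. *)
Record algPres (R : comPzRingType) := AlgPres {
  gen : choiceType;
  grel : seq gen -> seq gen -> Prop;
  gmul : gen -> gen -> gen;
  gmap : R -> gen;
  gmulA : forall x y z,
    fsum_eq grel [:: gmul x (gmul y z)] [:: gmul (gmul x y) z];
  gmulC : forall x y, fsum_eq grel [:: gmul x y] [:: gmul y x];
  gmul1 : forall x, fsum_eq grel [:: gmul (gmap 1) x] [:: x];
  gmul_rel : forall x s t, grel s t ->
    fsum_eq grel (map (gmul x) s) (map (gmul x) t);
  gmapM : forall r r',
    fsum_eq grel [:: gmap (r * r')] [:: gmul (gmap r) (gmap r')];
  gmapD : forall r r', fsum_eq grel [:: gmap (r + r')] [:: gmap r; gmap r'];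
  gmap0 : fsum_eq grel [:: gmap 0] [::]
}.

Section Presented.
Variables (R : comPzRingType) (P : algPres R).
Implicit Types (x y : gen P) (s t u : seq (gen P)).

Local Notation feq := (fsum_eq (@grel R P)).

Definition fsum_eqb s t : bool := `[< feq s t >].

Fact fsum_eqb_refl : reflexive fsum_eqb.
Proof. by move=> s; apply/asboolP/FsRefl. Qed.

Fact fsum_eqb_sym : symmetric fsum_eqb.
Proof. by move=> s t; apply/asboolP/asboolP => /FsSym. Qed.

Fact fsum_eqb_trans : transitive fsum_eqb.
Proof.
by move=> t s u /asboolP st /asboolP tu; apply/asboolP/(FsTrans st tu).
Qed.

Canonical fsum_equiv :=
  EquivRel fsum_eqb fsum_eqb_refl fsum_eqb_sym fsum_eqb_trans.

Definition presented : Type := {eq_quot fsum_eqb}.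
HB.instance Definition _ := Choice.on presented.

Definition pres_class s : presented := \pi_({eq_quot fsum_eqb}) s.
Definition pres_repr (a : presented) : seq (gen P) :=
  repr (a : {eq_quot fsum_eqb}).

Lemma pres_reprK a : pres_class (pres_repr a) = a.
Proof. exact: reprK. Qed.

Lemma pres_classP s t : pres_class s = pres_class t <-> feq s t.
Proof.
split=> [/eqmodP/asboolP //|st]; apply/eqmodP; exact/asboolP.
Qed.

Lemma feq_repr s : feq (pres_repr (pres_class s)) s.
Proof. by apply/pres_classP; rewrite pres_reprK. Qed.

Lemma presW (Q : presented -> Prop) :
  (forall s, Q (pres_class s)) -> forall a, Q a.
Proof. by move=> Qs a; rewrite -[a]pres_reprK. Qed.

Definition pres_add (a b : presented) : presented :=
  pres_class (pres_repr a ++ pres_repr b).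
Definition pres_mul (a b : presented) : presented :=
  pres_class [seq gmul x y | x <- pres_repr a, y <- pres_repr b].
Definition pres_map (r : R) : presented := pres_class [:: gmap P r].
Definition pres_opp (a : presented) : presented := pres_mul (pres_map (-1)) a.

Lemma feq_gmul x s t : feq s t -> feq (map (gmul x) s) (map (gmul x) t).
Proof.
elim=> {s t}.
- exact: gmul_rel.
- move=> s; exact: FsRefl.
- by move=> s t _; apply: FsSym.
- by move=> s t u _ + _; apply: FsTrans.
- by move=> s s' t t' _ IHs _ IHt; rewrite !map_cat; apply: FsCat.
- by move=> s t; rewrite !map_cat; apply: FsCatC.
Qed.

Lemma feq_pairsr s t t' : feq t t' ->
  feq [seq gmul x y | x <- s, y <- t] [seq gmul x y | x <- s, y <- t'].
Proof.
move=> tt'; elim: s => [|x s IHs] /=; first exact: FsRefl.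
by apply: FsCat => //; apply: feq_gmul.
Qed.

Lemma feq_pairsC s t :
  feq [seq gmul x y | x <- s, y <- t] [seq gmul x y | x <- t, y <- s].
Proof.
elim: s => [|x s IHs] /=.
  elim: t => [|y t IHt] /=; [exact: FsRefl|exact: IHt].
apply: FsTrans (FsCat (FsRefl _ _) IHs) _ => {IHs}.
elim: t => [|y t IHt] /=; first exact: FsRefl.
apply: (@FsCat _ _ [:: _] [:: _]); first exact: gmulC.
rewrite catA; apply: FsTrans (FsCat (FsCatC _ _ _) (FsRefl _ _)) _.
by rewrite -catA; apply: FsCat (FsRefl _ _) IHt.
Qed.

Lemma pres_addE s t :
  pres_add (pres_class s) (pres_class t) = pres_class (s ++ t).
Proof. by apply/pres_classP/FsCat; apply: feq_repr. Qed.

Lemma pres_mulE s t : pres_mul (pres_class s) (pres_class t) =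
  pres_class [seq gmul x y | x <- s, y <- t].
Proof.
apply/pres_classP; apply: FsTrans (feq_pairsr _ (feq_repr _)) _.
apply: FsTrans (feq_pairsC _ _) _; apply: FsTrans (feq_pairsC _ _).
exact/feq_pairsr/feq_repr.
Qed.

Fact pres_addA : associative pres_add.
Proof.
elim/presW=> s; elim/presW=> t; elim/presW=> u.
by rewrite !pres_addE catA.
Qed.

Fact pres_addC : commutative pres_add.
Proof.
elim/presW=> s; elim/presW=> t.
by rewrite !pres_addE; apply/pres_classP/FsCatC.
Qed.

Fact pres_add0 : left_id (pres_class [::]) pres_add.
Proof. by elim/presW=> s; rewrite pres_addE. Qed.

Fact pres_mulC : commutative pres_mul.
Proof.
elim/presW=> s; elim/presW=> t; rewrite !pres_mulE.
exact/pres_classP/feq_pairsC.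
Qed.

Fact pres_mulDl : left_distributive pres_mul pres_add.
Proof.
elim/presW=> s; elim/presW=> t; elim/presW=> u.
by rewrite !(pres_addE, pres_mulE) allpairs_cat.
Qed.

Fact pres_mul1 : left_id (pres_map 1) pres_mul.
Proof.
elim/presW=> s; rewrite pres_mulE /= cats0.
apply/pres_classP; elim: s => [|x s IHs] /=; first exact: FsRefl.
exact: FsCat (gmul1 x) IHs.
Qed.

Lemma pres_mapD r r' : pres_map (r + r') = pres_add (pres_map r) (pres_map r').
Proof. by rewrite pres_addE; apply/pres_classP/gmapD. Qed.

Fact pres_addN : left_inverse (pres_class [::]) pres_opp pres_add.
Proof.
move=> a; rewrite /pres_opp -[X in pres_add _ X]pres_mul1.
rewrite -pres_mulDl -pres_mapD addNr.
have -> : pres_map 0 = pres_class [::] by apply/pres_classP/gmap0.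
by elim/presW: a => s; rewrite pres_mulE.
Qed.

HB.instance Definition _ :=
  GRing.isZmodule.Build presented pres_addA pres_addC pres_add0 pres_addN.

Lemma pres_class0 : pres_class [::] = 0. Proof. by []. Qed.

Lemma pres_class_cat s t :
  pres_class (s ++ t) = pres_class s + pres_class t.
Proof. by symmetry; apply: pres_addE. Qed.

Lemma pres_class_cons x s :
  pres_class (x :: s) = pres_class [:: x] + pres_class s.
Proof. exact: (pres_class_cat [:: x]). Qed.

Fact pres_mulA : associative pres_mul.
Proof.
have mDl : left_distributive pres_mul +%R by exact: pres_mulDl.
have mDr : right_distributive pres_mul +%R.
  by move=> a b c; rewrite pres_mulC mDl !(pres_mulC a).
have m0l a : pres_mul 0 a = 0.
  by elim/presW: a => s; rewrite -pres_class0 pres_mulE.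
have m0r a : pres_mul a 0 = 0 by rewrite pres_mulC m0l.
elim/presW=> s; elim/presW=> t; elim/presW=> u.
elim: s => [|x s IHs]; first by rewrite !m0l.
rewrite [pres_class (x :: s)]pres_class_cons !mDl {}IHs; congr (_ + _).
elim: t => [|y t IHt]; first by rewrite !(m0l, m0r).
rewrite [pres_class (y :: t)]pres_class_cons !(mDl, mDr) {}IHt.
congr (_ + _).
elim: u => [|z u IHu]; first by rewrite !m0r.
rewrite [pres_class (z :: u)]pres_class_cons !mDr {}IHu.
by congr (_ + _); rewrite !pres_mulE; apply/pres_classP/gmulA.
Qed.

HB.instance Definition _ := GRing.Zmodule_isComPzRing.Build presented
  pres_mulA pres_mulC pres_mul1 pres_mulDl.

Lemma pres_classM s t : pres_class s * pres_class t =
  pres_class [seq gmul x y | x <- s, y <- t].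
Proof. exact: pres_mulE. Qed.

Fact pres_map_is_additive : additive pres_map.
Proof.
have mD r r' : pres_map (r + r') = pres_map r + pres_map r'.
  exact: pres_mapD.
by move=> r r'; apply: (addIr (pres_map r')); rewrite -mD !subrK.
Qed.

Fact pres_map_is_monoid_morphism : monoid_morphism pres_map.
Proof.
by split=> // r r'; rewrite pres_classM; apply/pres_classP/gmapM.
Qed.

HB.instance Definition _ :=
  GRing.isAdditive.Build R presented pres_map pres_map_is_additive.
HB.instance Definition _ :=
  GRing.isMonoidMorphism.Build R presented pres_map
    pres_map_is_monoid_morphism.

Definition pres_alg : comPzAlg R := @ComPzAlg R presented pres_map.

(* The additive extension of h to [presented]; the choice of representative
   is immaterial when h respects [grel], see [pres_liftE]. *)
Definition pres_lift (V : zmodType) (h : gen P -> V) (a : presented) : V :=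
  \sum_(x <- pres_repr a) h x.

Lemma pres_liftE (V : zmodType) (h : gen P -> V) s :
  (forall s t, grel s t -> \sum_(x <- s) h x = \sum_(x <- t) h x) ->
  pres_lift h (pres_class s) = \sum_(x <- s) h x.
Proof.
move=> hP; rewrite /pres_lift; move: (pres_repr _) (feq_repr s) => t.
elim=> {s t} //.
- by move=> s t u _ -> _ ->.
- by move=> s s' t t' _ IHs _ IHt; rewrite !big_cat /= IHs IHt.
- by move=> s t; rewrite !big_cat /= addrC.
Qed.

End Presented.

(* The symmetric algebra S(M): the tensor algebra of M made commutative. The
   one-term sum (r, [:: m1; ..; mk]) stands for r times the product of the
   m_i, regarded in S^1(M). *)
Section SymmetricAlgebra.
Variables (R : comPzRingType) (M : lmodType R).

Inductive sym_rel : seq (R * seq M) -> seq (R * seq M) -> Prop :=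
| SymCoefD r r' w : sym_rel [:: (r + r', w)] [:: (r, w); (r', w)]
| SymCoef0 w : sym_rel [:: (0, w)] [::]
| SymAdd r u m m' v : sym_rel [:: (r, u ++ (m + m') :: v)]
    [:: (r, u ++ m :: v); (r, u ++ m' :: v)]
| SymScale r u c m v : sym_rel [:: (r, u ++ (c *: m) :: v)]
    [:: (r * c, u ++ m :: v)]
| SymComm r w w' : perm_eq w w' -> sym_rel [:: (r, w)] [:: (r, w')].

Definition sym_gmul (x y : R * seq M) : R * seq M := (x.1 * y.1, x.2 ++ y.2).
Definition sym_gmap (r : R) : R * seq M := (r, [::]).

Fact sym_gmulA x y z : fsum_eq sym_rel
  [:: sym_gmul x (sym_gmul y z)] [:: sym_gmul (sym_gmul x y) z].
Proof. by rewrite /sym_gmul /= mulrA catA; apply: FsRefl. Qed.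

Fact sym_gmulC x y : fsum_eq sym_rel [:: sym_gmul x y] [:: sym_gmul y x].
Proof.
by rewrite /sym_gmul mulrC; apply/FsRel/SymComm; rewrite perm_catC.
Qed.

Fact sym_gmul1 x : fsum_eq sym_rel [:: sym_gmul (sym_gmap 1) x] [:: x].
Proof. by case: x => r w; rewrite /sym_gmul /= mul1r; apply: FsRefl. Qed.

Fact sym_gmul_rel x s t : sym_rel s t ->
  fsum_eq sym_rel (map (sym_gmul x) s) (map (sym_gmul x) t).
Proof.
rewrite /sym_gmul => st; apply: FsRel; case: st => /=.
- by move=> r r' w; rewrite mulrDr; apply: SymCoefD.
- by move=> w; rewrite mulr0; apply: SymCoef0.
- by move=> r u m m' v; rewrite !catA; apply: SymAdd.
- by move=> r u c m v; rewrite !catA mulrA; apply: SymScale.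
- by move=> r w w' ww'; apply: SymComm; rewrite perm_cat2l.
Qed.

Fact sym_gmapM r r' : fsum_eq sym_rel
  [:: sym_gmap (r * r')] [:: sym_gmul (sym_gmap r) (sym_gmap r')].
Proof. exact: FsRefl. Qed.

Fact sym_gmapD r r' : fsum_eq sym_rel
  [:: sym_gmap (r + r')] [:: sym_gmap r; sym_gmap r'].
Proof. exact/FsRel/SymCoefD. Qed.

Fact sym_gmap0 : fsum_eq sym_rel [:: sym_gmap 0] [::].
Proof. exact/FsRel/SymCoef0. Qed.

Definition sym_pres : algPres R :=
  @AlgPres R (R * seq M)%type sym_rel sym_gmul sym_gmap
    sym_gmulA sym_gmulC sym_gmul1 sym_gmul_rel sym_gmapM sym_gmapD sym_gmap0.

Definition symAlg : comPzAlg R := pres_alg sym_pres.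

Definition sym_inj (m : M) : symAlg := @pres_class R sym_pres [:: (1, [:: m])].

Lemma sym_injD : {morph sym_inj : m m' / m + m'}.
Proof.
move=> m m'; rewrite /sym_inj -pres_class_cat.
exact/pres_classP/FsRel/(SymAdd 1 [::]).
Qed.

Lemma sym_injZ (r : R) m : sym_inj (r *: m) = alg_map symAlg r * sym_inj m.
Proof.
rewrite /sym_inj [RHS]pres_classM; apply/pres_classP.
rewrite /= /sym_gmul /= mulrC; exact/FsRel/(SymScale 1 [::]).
Qed.

End SymmetricAlgebra.

(* The tensor product algebra of A and B over R: formal sums of pure tensors
   modulo R-bilinearity. *)
Section TensorProduct.
Variables (R : comPzRingType) (A B : comPzAlg R).

Inductive tens_rel : seq (A * B) -> seq (A * B) -> Prop :=
| TensAddl a a' b : tens_rel [:: (a + a', b)] [:: (a, b); (a', b)]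
| TensAddr a b b' : tens_rel [:: (a, b + b')] [:: (a, b); (a, b')]
| TensBal r a b : tens_rel [:: (alg_map A r * a, b)] [:: (a, alg_map B r * b)]
| Tens0 b : tens_rel [:: (0, b)] [::].

Definition tens_gmul (x y : A * B) : A * B := (x.1 * y.1, x.2 * y.2).
Definition tens_gmap (r : R) : A * B := (alg_map A r, 1).

Fact tens_gmulA x y z : fsum_eq tens_rel
  [:: tens_gmul x (tens_gmul y z)] [:: tens_gmul (tens_gmul x y) z].
Proof. by rewrite /tens_gmul /= !mulrA; apply: FsRefl. Qed.

Fact tens_gmulC x y : fsum_eq tens_rel [:: tens_gmul x y] [:: tens_gmul y x].
Proof. by rewrite /tens_gmul mulrC (mulrC x.2); apply: FsRefl. Qed.

Fact tens_gmul1 x : fsum_eq tens_rel [:: tens_gmul (tens_gmap 1) x] [:: x].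
Proof.
by case: x => a b; rewrite /tens_gmul /= rmorph1 !mul1r; apply: FsRefl.
Qed.

Fact tens_gmul_rel x s t : tens_rel s t ->
  fsum_eq tens_rel (map (tens_gmul x) s) (map (tens_gmul x) t).
Proof.
rewrite /tens_gmul => st; apply: FsRel; case: st => /=.
- by move=> *; rewrite mulrDr; apply: TensAddl.
- by move=> *; rewrite mulrDr; apply: TensAddr.
- by move=> r a b; rewrite !(mulrCA _ (alg_map _ r)); apply: TensBal.
- by move=> *; rewrite mulr0; apply: Tens0.
Qed.

Fact tens_gmapM r r' : fsum_eq tens_rel
  [:: tens_gmap (r * r')] [:: tens_gmul (tens_gmap r) (tens_gmap r')].
Proof. by rewrite /tens_gmul /tens_gmap rmorphM mulr1; apply: FsRefl. Qed.

Fact tens_gmapD r r' : fsum_eq tens_rel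
  [:: tens_gmap (r + r')] [:: tens_gmap r; tens_gmap r'].
Proof. by rewrite /tens_gmap rmorphD; apply/FsRel/TensAddl. Qed.

Fact tens_gmap0 : fsum_eq tens_rel [:: tens_gmap 0] [::].
Proof. by rewrite /tens_gmap rmorph0; apply/FsRel/Tens0. Qed.

Definition tens_pres : algPres R :=
  @AlgPres R (A * B)%type tens_rel tens_gmul tens_gmap
    tens_gmulA tens_gmulC tens_gmul1 tens_gmul_rel
    tens_gmapM tens_gmapD tens_gmap0.

Definition tensAlg : comPzAlg R := pres_alg tens_pres.

Definition tens (a : A) (b : B) : tensAlg := @pres_class R tens_pres [:: (a, b)].

Lemma tensDl a a' b : tens (a + a') b = tens a b + tens a' b.
Proof. by rewrite /tens -pres_class_cat; apply/pres_classP/FsRel/TensAddl. Qed.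

Lemma tensDr a b b' : tens a (b + b') = tens a b + tens a b'.
Proof. by rewrite /tens -pres_class_cat; apply/pres_classP/FsRel/TensAddr. Qed.

Lemma tensM a b a' b' : tens a b * tens a' b' = tens (a * a') (b * b').
Proof. exact: pres_classM. Qed.

Lemma tensZl r a b : tens (alg_map A r * a) b = alg_map tensAlg r * tens a b.
Proof. by rewrite [RHS]tensM mul1r. Qed.

Lemma tensZr r a b : tens a (alg_map B r * b) = alg_map tensAlg r * tens a b.
Proof. by rewrite -tensZl; apply/esym/pres_classP/FsRel/TensBal. Qed.

Lemma tens_ind (Q : tensAlg -> Prop) : Q 0 -> (forall a b, Q (tens a b)) ->
  (forall x y, Q x -> Q y -> Q (x + y)) -> forall x, Q x.
Proof.
move=> Q0 Qt QD; apply: (@presW R tens_pres) => s; elim: s => [|[a b] s IHs]; first exact: Q0.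
by rewrite pres_class_cons; apply: QD; [apply: Qt|apply: IHs].
Qed.

(* The additive map induced by a balanced biadditive h. *)
Definition tens_lift (V : zmodType) (h : A -> B -> V) : tensAlg -> V :=
  @pres_lift R tens_pres V (fun x => h x.1 x.2).

Section Lift.
Variables (V : zmodType) (h : A -> B -> V).
Hypotheses (hDl : forall a a' b, h (a + a') b = h a b + h a' b)
  (hDr : forall a b b', h a (b + b') = h a b + h a b')
  (hBal : forall r a b, h (alg_map A r * a) b = h a (alg_map B r * b)).

Let h_rel s t : tens_rel s t ->
  \sum_(x <- s) h x.1 x.2 = \sum_(x <- t) h x.1 x.2.
Proof.
case=> [a a' b|a b b'|r a b|b]; rewrite !big_cons !big_nil ?addr0 //=.
by apply: (addrI (h 0 b)); rewrite -hDl !addr0.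
Qed.

Lemma tens_lift_tens a b : tens_lift h (tens a b) = h a b.
Proof. by rewrite /tens_lift pres_liftE //= big_seq1. Qed.

Lemma tens_liftD : {morph tens_lift h : x y / x + y}.
Proof.
apply: (@presW R tens_pres) => s; apply: (@presW R tens_pres) => t.
rewrite -pres_class_cat /tens_lift.
by rewrite !pres_liftE //= big_cat.
Qed.

End Lift.

End TensorProduct.

Section FreeAveraging.
Variables (R : comPzRingType) (A : comPzAlg R).

Local Notation S := (symAlg (alg_mod A)).

Definition free_avg_alg : comPzAlg R := tensAlg A S.

Definition free_avg_op : free_avg_alg -> free_avg_alg :=
  tens_lift (fun (a : A) (s : S) => tens 1 (sym_inj (a : alg_mod A) * s)).

Let h (a : A) (s : S) : free_avg_alg := tens 1 (sym_inj (a : alg_mod A) * s).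

Let hDl a a' s : h (a + a') s = h a s + h a' s.
Proof. by rewrite /h (sym_injD (_ : alg_mod A)) mulrDl tensDr. Qed.

Let hDr a s s' : h a (s + s') = h a s + h a s'.
Proof. by rewrite /h mulrDr tensDr. Qed.

Let hBal r a s : h (alg_map A r * a) s = h a (alg_map S r * s).
Proof. by rewrite /h (sym_injZ r (a : alg_mod A)) mulrCA mulrA. Qed.

Lemma free_avg_opE a s :
  free_avg_op (tens a s) = tens 1 (sym_inj (a : alg_mod A) * s).
Proof. exact: (tens_lift_tens hDl hDr hBal). Qed.

Lemma free_avg_opD : {morph free_avg_op : x y / x + y}.
Proof. exact: (tens_liftD hDl hDr hBal). Qed.

Lemma free_avg_op0 : free_avg_op 0 = 0.
Proof. by apply: (addrI (free_avg_op 0)); rewrite -free_avg_opD !addr0. Qed.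

Fact free_avg_op_linear :
  linear (free_avg_op : alg_mod free_avg_alg -> alg_mod free_avg_alg).
Proof.
move=> r x y; rewrite [LHS]free_avg_opD; congr (_ + _).
rewrite /GRing.scale /= /alg_scale.
elim/tens_ind: x => [|a s|x x' IHx IHx'].
- by rewrite !(mulr0, free_avg_op0).
- by rewrite -tensZr !free_avg_opE -tensZr mulrCA.
- by rewrite mulrDr !free_avg_opD IHx IHx' mulrDr.
Qed.

Fact free_avg_opP x y :
  free_avg_op (x * free_avg_op y) = free_avg_op x * free_avg_op y.
Proof.
elim/tens_ind: x => [|a s|x x' IHx IHx'].
- by rewrite free_avg_op0 !mul0r free_avg_op0.
- elim/tens_ind: y => [|b t|y y' IHy IHy'].
  + by rewrite free_avg_op0 !mulr0 free_avg_op0.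
  + by rewrite !free_avg_opE !tensM free_avg_opE !mulr1 mulrA.
  + by rewrite free_avg_opD !mulrDr free_avg_opD IHy IHy'.
- by rewrite free_avg_opD !mulrDl free_avg_opD IHx IHx'.
Qed.

Definition free_avg : averagingAlg R :=
  @AveragingAlg R free_avg_alg free_avg_op free_avg_op_linear free_avg_opP.

End FreeAveraging.

(* Main.v *)
(* The augmentation S(A) -> R induces a surjective ring morphism
   eps : F_A = A (x) S(A) -> A.  The image of f_A has positive degree in S(A),
   hence lies in ker eps, so the preimage under eps of any ideal of A is an
   averaging ideal.  Strictly ascending chains of ideals of A thus pull back to
   strictly ascending chains of averaging ideals. *)
Require Import Defs.
From mathcomp Require Import all_boot all_algebra.
From mathcomp Require Import classical_sets.

Set Implicit Arguments.
Unset Strict Implicit.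
Unset Printing Implicit Defensive.

Import GRing.Theory.
Local Open Scope ring_scope.

Section PresLift.
Variables (R : comPzRingType) (P : algPres R) (V : pzRingType).
Variable h : gen P -> V.
Hypothesis h_rel :
  forall s t, Defs.grel s t -> \sum_(x <- s) h x = \sum_(x <- t) h x.

Lemma pres_liftD : {morph pres_lift h : a b / a + b}.
Proof.
elim/presW=> s; elim/presW=> t.
by rewrite -pres_class_cat !pres_liftE // big_cat.
Qed.

(** Multiplicativity need only be checked on generators: a product of classes is the formal sum of
    all pairwise products, so distributivity in [V] does the rest. *)
Lemma pres_liftM : {morph h : x y / gmul x y >-> x * y} ->
  {morph pres_lift h : a b / a * b}.
Proof.
move=> hM; elim/presW=> s; elim/presW=> t.
rewrite pres_classM !pres_liftE // big_allpairs_dep mulr_suml.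
by apply: eq_bigr => x _; rewrite mulr_sumr; apply: eq_bigr => y _; apply: hM.
Qed.

End PresLift.

Section Augmentation.
Variables (R : comPzRingType) (M : lmodType R).

(** Projection of a monomial onto degree zero: the word length is the degree in S(M). *)
Definition sym_gen_aug (x : R * seq M) : R := if nilp x.2 then x.1 else 0.

Definition sym_aug : symAlg M -> R := @pres_lift R (sym_pres M) R sym_gen_aug.

(** The relations respect word length: additivity and scaling in [M] involve only nonempty words,
    where both sides vanish; permuting a word keeps its length; the coefficient relations are
    additive in the coefficient. *)
Lemma sym_gen_aug_rel s t : sym_rel s t ->
  \sum_(x <- s) sym_gen_aug x = \sum_(x <- t) sym_gen_aug x.
Proof.
have nilpN u (m : M) v : nilp (u ++ m :: v) = false by case: u.
rewrite /sym_gen_aug; case=> [r r' w|w|r u m m' v|r u c m v|r w w' ww'];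
  rewrite !big_cons !big_nil ?addr0 /= ?nilpN ?addr0 //.
- by case: nilp; rewrite ?addr0.
- by case: nilp.
- by rewrite /nilp (perm_size ww').
Qed.

Lemma sym_augD : {morph sym_aug : s t / s + t}.
Proof. exact: (@pres_liftD R (sym_pres M) R _ sym_gen_aug_rel). Qed.

Lemma sym_augM : {morph sym_aug : s t / s * t}.
Proof.
(* A concatenation is empty exactly when both words are. *)
apply: (@pres_liftM R (sym_pres M) R _ sym_gen_aug_rel) => -[r [|m w]] [r' [|m' w']];
  by rewrite /sym_gen_aug /= ?mul0r ?mulr0.
Qed.

Lemma sym_aug_map r : sym_aug (alg_map (symAlg M) r) = r.
Proof.
by rewrite /sym_aug (@pres_liftE R (sym_pres M) R _ _ sym_gen_aug_rel) big_seq1.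
Qed.

Lemma sym_aug_inj m : sym_aug (sym_inj m) = 0.
Proof.
by rewrite /sym_aug (@pres_liftE R (sym_pres M) R _ _ sym_gen_aug_rel) big_seq1.
Qed.

End Augmentation.

Section FreeAugmentation.
Variables (R : comPzRingType) (A : comPzAlg R).

Local Notation S := (symAlg (alg_mod A)).

(** The map id (x) [sym_aug] from A (x) S(A) to A (x) R, followed by the identification of A (x) R
    with [A]. *)
Let h (a : A) (s : S) : A := a * alg_map A (sym_aug s).

Let hDl a a' s : h (a + a') s = h a s + h a' s.
Proof. exact: mulrDl. Qed.

Let hDr a s s' : h a (s + s') = h a s + h a s'.
Proof. by rewrite /h sym_augD rmorphD mulrDr. Qed.

Let hBal r a s : h (alg_map A r * a) s = h a (alg_map S r * s).
Proof. by rewrite /h sym_augM sym_aug_map rmorphM mulrCA mulrA. Qed.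

Definition free_aug : free_avg A -> A := tens_lift h.

Lemma free_aug_tens a s : free_aug (tens a s) = a * alg_map A (sym_aug s).
Proof. exact: (tens_lift_tens hDl hDr hBal). Qed.

Lemma free_augD : {morph free_aug : x y / x + y}.
Proof. exact: (tens_liftD hDl hDr hBal). Qed.

Lemma free_aug0 : free_aug 0 = 0.
Proof. by apply: (addrI (free_aug 0)); rewrite -free_augD !addr0. Qed.

Lemma free_augM : {morph free_aug : x y / x * y}.
Proof.
move=> x y; elim/tens_ind: x => [|a s|x x' IHx IHx'].
- by rewrite mul0r free_aug0 mul0r.
- elim/tens_ind: y => [|b t|y y' IHy IHy'].
  + by rewrite mulr0 free_aug0 mulr0.
  + by rewrite tensM !free_aug_tens sym_augM rmorphM mulrACA.
  + by rewrite mulrDr !free_augD IHy IHy' mulrDr.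
- by rewrite mulrDl !free_augD IHx IHx' mulrDl.
Qed.

(** The structure map of the free algebra is a section of [free_aug]; this gives surjectivity. *)
Lemma free_aug_in a : free_aug (tens a 1) = a.
Proof.
by rewrite free_aug_tens -(rmorph1 (alg_map S)) sym_aug_map rmorph1 mulr1.
Qed.

Lemma free_aug_op x : free_aug (avg_op x) = 0.
Proof.
elim/tens_ind: x => [|a s|x y IHx IHy].
- by rewrite [avg_op _]free_avg_op0 free_aug0.
- rewrite [avg_op _]free_avg_opE free_aug_tens sym_augM sym_aug_inj.
  by rewrite mul0r rmorph0 mulr0.
- by rewrite [avg_op _]free_avg_opD free_augD IHx IHy addr0.
Qed.

Local Open Scope classical_set_scope.

Lemma averaging_ideal_preimage_aug (I : set A) :
  is_ideal I -> is_averaging_ideal (X := free_avg A) (free_aug @^-1` I).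
Proof.
case=> I0 ID IM; split; first split.
- by rewrite /preimage /= free_aug0.
- by move=> x y; rewrite /preimage /= free_augD; apply: ID.
- by move=> a x; rewrite /preimage /= free_augM; apply: IM.
(* The operator lands in the kernel of [free_aug], so stability reduces to [I] containing 0. *)
- by move=> _ [x _ <-]; rewrite /preimage /= free_aug_op.
Qed.

(** Strictness survives by surjectivity: if the preimage of [J] lay in that of [I], lifting each [a]
    in [J] to [tens a 1] would put [a] in [I]. *)
Lemma preimage_aug_proper (I J : set A) :
  I `<` J -> free_aug @^-1` I `<` free_aug @^-1` J.
Proof.
case=> IJ nJI; split=> [x /IJ //|JI]; apply: nJI => a Ja.
by rewrite -[a]free_aug_in; apply: JI; rewrite /preimage /= free_aug_in.
Qed.

End FreeAugmentation.

Theorem theorem3p5 (R : comPzRingType) (A : comPzAlg R) :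
  noetherian R -> noetherian_averaging (free_avg A) -> noetherian A.
Proof.
move=> _ noethF [I [idI ltI]]; apply: noethF.
exists (fun n => free_aug (A := A) @^-1` I n)%classic; split=> n.
  exact: averaging_ideal_preimage_aug.
exact: preimage_aug_proper.
Qed.
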